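(* Let $(T,M,\mu)$ be an ergodic system: $T:M\to M$ preserves the ergodic probability measure $\mu$. Let $\phi:M\to[0,1)$ satisfy $\log\phi\in L^1(\mu)$ and $\int\log\phi\,d\mu<0$. Let $q\ge1$ be an integer and take $n_k=q$ for all $k$. For $x\in M$ let $F=F(x)\subset\mathbb{R}^d$ be a homogeneous generalized Moran set (GMS) arising from a Moran structure with vector $$\Psi^{(k)}_\omega=\prod_{j=1}^k\phi(T^j(x)),\qquad \omega\in D_k,$$ i.e. $c^{(k)}_i=\phi(T^k(x))$ for $1\le i\le q$, and suppose that this vector is basic, is both (LE) and (UE), and that (A3) holds. Then for $\mu$-a.e. $x\in M$, $$\dim_H(F)=\dim_P(F)=\overline{\dim}_B(F)=\frac{-\log q}{\int\log\phi\,d\mu}.$$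
   Context: **Words.** $d\ge1$, $n_k=q$ for all $k$. Let $D_k=\{1,\dots,q\}^k$, $D_0=\{\emptyset\}$, $D=\bigcup_{k\ge0}D_k$, $D^*=\{1,\dots,q\}^{\mathbb{N}}$. For $\omega\in D_{k-1}$ and $1\le j\le q$, $\omega*j\in D_k$ is the concatenation. **Class $\Im$.** A map $f:\mathbb{R}^d\to\mathbb{R}^d$ is in $\Im$ if there is a compact set $A$ with $f(A)\subset A$ such that $\mathrm{diam}(f^n(B))\to0$ as $n\to\infty$ for every compact $B\subset A$. **Moran structure and GMS.** Let $\triangle\subset\mathbb{R}^d$ be compact and $f_{k,j}\in\Im$ ($k\ge1$, $1\le j\le q$). For $\omega=(i_1,\dots,i_k)\in D_k$ put $f_\omega=f_{1,i_1}\circ\cdots\circ f_{k,i_k}$ and $\triangle_\omega=f_\omega(\triangle)$, $\triangle_\emptyset=\triangle$. It is assumed that all $\triangle_\omega$ are compact, $\triangle_{\omega*j}\subseteq\triangle_\omega$ whenever $\omega\in D_{k-1}$, $\omega*j\in D_k$, and $\lim_{k\to\infty}\max_{\omega\in D_k}\mathrm{diam}(\triangle_\omega)=0$. Put $F=\bigcap_{k}\bigcup_{\omega\in D_k}\triangle_\omega$. $F$ is a generalized Moran set (GMS) if moreover $\triangle_\omega\cap\triangle_{\omega'}\cap F=\emptyset$ for all $k$ and all distinct $\omega,\omega'\in D_k$. Then each $x\in F$ equals $\bigcap_k\triangle_{(i_1,\dots,i_k)}$ for a unique $(i_j)_{j\ge1}\in D^*$, its coding. **Vectors.** Given constants $c^{(k)}_j$,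 $\Psi^{(k)}_\omega=\Psi^{(k)}(\omega)=\prod_{j=1}^k c^{(j)}_{i_j}$ for $\omega=(i_1,\dots,i_k)\in D_k$. The collection $\overline\Psi=\{(\Psi^{(k)}_\omega)_{\omega\in D_k}\}_{k\ge1}$ is *basic* if $\sup_{k,j}c^{(k)}_j<1$. A basic collection is (UE) if there is $C>0$ with $\mathrm{diam}(\triangle_\omega)\le C\Psi^{(k)}_\omega$ for all $k$, $\omega\in D_k$. *(LE).* For $0<r<1$ and $y\in F$ with coding $(i_j)$, let $n(y)$ be the unique integer with $\Psi^{(n(y))}_{(i_1,\dots,i_{n(y)})}>r$ and $\Psi^{(n(y)+1)}_{(i_1,\dots,i_{n(y)+1})}\le r$ (convention $\Psi^{(0)}=1$), and let $\triangle(y)$ be the set of points of $F$ whose codings begin with $(i_1,\dots,i_{n(y)})$. The distinct sets among the $\triangle(y)$ form the Moran covering $\{\triangle^{(j)}\}$ of $F$ at scale $r$. Let $N(y,r)$ be the number of $\triangle^{(j)}$ meeting the open ball $B(y,r)$. A basic collection is (LE) if there is a constant $M_0$ with $N(y,r)<M_0$ for all $y\in F$, $0<r<1$. *Homogeneous.* The construction (and $F$) is homogeneous if $\Psi^{(k)}_\omega=\Psi^{(k)}_{\omega'}$ for all $k$, $\omega,\omega'\in D_k$, and the vector is both (UE) and (LE). **(A3).** For every $\beta>0$ there are a Borel probability measure $m_\Psi$ (depending on $\beta$) supported on $F$ and $L>0$ such that for all $k\ge1$, $\omega\in D_k$: $$\frac{L^{-1}}{\sum_{\omega'\in D_k}(\Psi^{(k)}(\omega'))^{\beta}}\le\frac{m_\Psi(\triangle_\omega)}{(\Psi^{(k)}(\omega))^\beta}\le\frac{L}{\sum_{\omega'\in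 D_k}(\Psi^{(k)}(\omega'))^{\beta}}.$$ $\dim_H,\dim_P,\overline{\dim}_B$ are Hausdorff, packing and upper box dimension. *)

(* Defs.v *)
(* R^d is 'rV[R]_d, for an arbitrary R : realType. *)
From HB Require Import structures.
From mathcomp Require Export all_boot all_order all_algebra.
From mathcomp Require Export finmap.
From mathcomp Require Export all_classical all_reals all_analysis.
Export Order.TTheory GRing.Theory Num.Theory.
Export numFieldNormedType.Exports.

Set Implicit Arguments.
Unset Strict Implicit.
Unset Printing Implicit Defensive.

Local Open Scope classical_set_scope.
Local Open Scope ring_scope.

Definition ergodic_system (R : realType) (disp : measure_display)
    (M : measurableType disp) (mu : probability M R) (T : M -> M) : Prop :=
  [/\ measurable_fun [set: M] T,
      (forall A, measurable A -> mu (T @^-1` A) = mu A) &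
      (forall A, measurable A -> T @^-1` A = A ->
         mu A = 0%E \/ mu A = 1%E)].

(* The library norm on 'rV[R]_d is the sup norm: it induces the usual topology,
   but distances, diameters and balls are taken here in the Euclidean metric. *)
Definition eucl_dist (R : realType) (d : nat) (x y : 'rV[R]_d) : R :=
  Num.sqrt (\sum_(i < d) (x 0 i - y 0 i) ^+ 2).

Definition eucl_ball (R : realType) (d : nat) (x : 'rV[R]_d) (r : R) :=
  [set y | eucl_dist x y < r].

Definition eucl_cball (R : realType) (d : nat) (x : 'rV[R]_d) (r : R) :=
  [set y | eucl_dist x y <= r].

(* The maximum with 0 only matters for the empty set, of diameter 0. *)
Definition diam (R : realType) (d : nat) (A : set 'rV[R]_d) : \bar R :=
  Order.max 0%E (ereal_sup [set (eucl_dist x y)%:E | x in A & y in A]).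

Definition borel_space (R : realType) (d : nat) :=
  g_sigma_algebraType (@open 'rV[R]_d).

(* |U|^s; since 0 `^ 0 = 1, the empty set has to be given weight 0 explicitly
   (this matters for s = 0, where the weight of a nonempty set is 1). *)
Definition hausdorff_weight (R : realType) (d : nat) (s : R)
    (U : set 'rV[R]_d) : \bar R :=
  if U == set0 then 0%E else (diam U `^ s)%E.

Definition hausdorff_delta (R : realType) (d : nat) (s delta : R)
    (A : set 'rV[R]_d) : \bar R :=
  ereal_inf [set (\sum_(0 <= i <oo) hausdorff_weight s (U i))%E | U in
    [set U : (set 'rV[R]_d)^nat |
      A `<=` \bigcup_i U i /\ forall i, (diam (U i) <= delta%:E)%E]].

Definition hausdorff_measure (R : realType) (d : nat) (s : R)
    (A : set 'rV[R]_d) : \bar R :=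
  ereal_sup [set hausdorff_delta s delta A | delta in [set delta | 0 < delta]].

Definition hausdorff_dim (R : realType) (d : nat) (A : set 'rV[R]_d) : \bar R :=
  ereal_inf [set s%:E | s in [set s | 0 <= s /\ hausdorff_measure s A = 0%E]].

(* Supremum of sum (2 r_i)^s over finite or countable families, indexed by a
   set D of naturals, of disjoint closed balls centred in A of radii <= delta. *)
Definition packing_delta (R : realType) (d : nat) (s delta : R)
    (A : set 'rV[R]_d) : \bar R :=
  ereal_sup [set v | exists (D : set nat) (x : nat -> 'rV[R]_d) (r : nat -> R),
    [/\ (forall i, D i -> A (x i) /\ 0 < r i <= delta),
        trivIset D (fun i => eucl_cball (x i) (r i)) &
        v = (\esum_(i in D) ((2 * r i) `^ s)%:E)%E]].

Definition packing_premeasure (R : realType) (d : nat) (s : R)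
    (A : set 'rV[R]_d) : \bar R :=
  ereal_inf [set packing_delta s delta A | delta in [set delta | 0 < delta]].

Definition packing_measure (R : realType) (d : nat) (s : R)
    (A : set 'rV[R]_d) : \bar R :=
  ereal_inf [set (\sum_(0 <= i <oo) packing_premeasure s (V i))%E | V in
    [set V : (set 'rV[R]_d)^nat | A `<=` \bigcup_i V i]].

Definition packing_dim (R : realType) (d : nat) (A : set 'rV[R]_d) : \bar R :=
  ereal_inf [set s%:E | s in [set s | 0 <= s /\ packing_measure s A = 0%E]].

(* Least number of sets of diameter <= r covering A (+oo if there is none). *)
Definition covering_number (R : realType) (d : nat) (A : set 'rV[R]_d) (r : R)
    : \bar R :=
  ereal_inf [set n%:R%:E | n in [set n : nat |
    exists U : 'I_n -> set 'rV[R]_d,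
      A `<=` \bigcup_(i in [set: 'I_n]) U i /\
      forall i, (diam (U i) <= r%:E)%E]].

Definition upper_box_dim (R : realType) (d : nat) (A : set 'rV[R]_d) : \bar R :=
  limf_esup (fun r : R => lne (covering_number A r) * ((- ln r)^-1)%:E)%E 0^'+.

(* A is required to be nonempty: A = set0 would make the condition vacuous. *)
Definition class_Im (R : realType) (d : nat) (f : 'rV[R]_d -> 'rV[R]_d) : Prop :=
  exists A : set 'rV[R]_d, [/\ compact A, A !=set0, f @` A `<=` A &
    forall B, compact B -> B `<=` A ->
      (fun n => diam (iter n f @` B)) @ \oo --> 0%E].

(* D_k is k.-tuple 'I_q: the letters are 0, ..., q-1, whereas the levels k of
   mmap (and of the constants c below) are numbered from 1; level 0 is unused. *)
Record moran_data (R : realType) (d q : nat) := MoranData {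
  mbase : set 'rV[R]_d ;
  mmap : nat -> 'I_q -> 'rV[R]_d -> 'rV[R]_d }.

(* comp_from f k [:: i_1; ...; i_n] = f_(k,i_1) \o ... \o f_(k+n-1,i_n) *)
Fixpoint comp_from (q : nat) (E : Type) (f : nat -> 'I_q -> E -> E) (k : nat)
    (w : seq 'I_q) : E -> E :=
  if w is i :: w' then f k i \o comp_from f k.+1 w' else id.

Definition tri (R : realType) (d q : nat) (S : moran_data R d q) (w : seq 'I_q) :
    set 'rV[R]_d :=
  comp_from (mmap S) 1 w @` mbase S.

Definition moran_structure (R : realType) (d q : nat) (S : moran_data R d q) :
    Prop :=
  [/\ compact (mbase S),
      (forall k j, (1 <= k)%N -> class_Im (mmap S k j)),
      (forall k (w : k.-tuple 'I_q), compact (tri S w)),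
      (forall k (w : k.-tuple 'I_q) j, tri S (rcons w j) `<=` tri S w) &
      (fun k => (\big[Order.max/0]_(w : k.-tuple 'I_q) diam (tri S w))%E)
        @ \oo --> 0%E].

Definition moran_set (R : realType) (d q : nat) (S : moran_data R d q) :
    set 'rV[R]_d :=
  \bigcap_(k in [set: nat]) \bigcup_(w in [set: k.-tuple 'I_q]) tri S w.

Definition is_GMS (R : realType) (d q : nat) (S : moran_data R d q) : Prop :=
  moran_structure S /\
  forall k (w w' : k.-tuple 'I_q), w != w' ->
    tri S w `&` tri S w' `&` moran_set S = set0.

(* An infinite word (i_j)_(j >= 1) is a function u with u j = i_(j+1). *)
Definition prefix_word (q : nat) (u : nat -> 'I_q) (n : nat) : n.-tuple 'I_q :=
  [tuple u j | j < n].

Definition codes (R : realType) (d q : nat) (S : moran_data R d q)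
    (u : nat -> 'I_q) (x : 'rV[R]_d) : Prop :=
  [set x] = \bigcap_(k in [set: nat]) tri S (prefix_word u k).

Definition Psi (R : realType) (q : nat) (c : nat -> 'I_q -> R) (k : nat)
    (w : k.-tuple 'I_q) : R :=
  \prod_(j < k) c j.+1 (tnth w j).

Definition basic (R : realType) (q : nat) (c : nat -> 'I_q -> R) : Prop :=
  (ereal_sup [set z | exists k j, (1 <= k)%N /\ z = (c k j)%:E] < 1)%E.

Definition UE (R : realType) (d q : nat) (S : moran_data R d q)
    (c : nat -> 'I_q -> R) : Prop :=
  exists C : R, 0 < C /\
    forall k (w : k.-tuple 'I_q), (1 <= k)%N -> (diam (tri S w) <= (C * Psi c w)%:E)%E.

Definition cylinder (R : realType) (d q : nat) (S : moran_data R d q)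
    (n : nat) (w : n.-tuple 'I_q) : set 'rV[R]_d :=
  [set z | moran_set S z /\ exists u, codes S u z /\ prefix_word u n = w].

(* The unique n with r < Psi (i_1..i_n) and Psi (i_1..i_n.+1) <= r, for y in F
   coded by u, determines the block of y; equal blocks are identified since the
   covering is a set of sets. *)
Definition moran_covering (R : realType) (d q : nat) (S : moran_data R d q)
    (c : nat -> 'I_q -> R) (r : R) : set (set 'rV[R]_d) :=
  [set A | exists y u n,
    [/\ moran_set S y, codes S u y,
        r < Psi c (prefix_word u n), Psi c (prefix_word u n.+1) <= r &
        A = cylinder S (prefix_word u n)]].

Definition LE (R : realType) (d q : nat) (S : moran_data R d q)
    (c : nat -> 'I_q -> R) : Prop :=
  exists M0 : nat, forall y r, moran_set S y -> 0 < r < 1 ->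
    let N := [set A | moran_covering S c r A /\ A `&` eucl_ball y r !=set0] in
    finite_set N /\ (#|` fset_set N| < M0)%N.

Definition homogeneous (R : realType) (d q : nat) (S : moran_data R d q)
    (c : nat -> 'I_q -> R) : Prop :=
  [/\ (forall k (w w' : k.-tuple 'I_q), Psi c w = Psi c w'),
      UE S c & LE S c].

(* m lives on the Borel sigma-algebra; "supported on F" is m F = 1, F being
   closed. *)
Definition A3 (R : realType) (d q : nat) (S : moran_data R d q)
    (c : nat -> 'I_q -> R) : Prop :=
  forall beta : R, 0 < beta ->
  exists (m : probability (borel_space R d) R) (L : R),
    [/\ m (moran_set S) = 1%E, 0 < L &
        forall k (w : k.-tuple 'I_q), (1 <= k)%N ->
          L^-1 / (\sum_(w' : k.-tuple 'I_q) Psi c w' `^ beta)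
            <= fine (m (tri S w)) / (Psi c w `^ beta)
            <= L / (\sum_(w' : k.-tuple 'I_q) Psi c w' `^ beta)].

(* Main.v *)
Require Import Defs.
From mathcomp Require Import measurable_realfun lra ring.

(** Write P_n for the product of phi (T^j x) over 1 <= j <= n and lam for the
    integral of ln phi, so that s = - ln q / lam.

    - Ergodicity gives, for almost every x, exponential bounds on P_n from both
      sides: P_n <= K r^n for every r > e^lam, and P_n >= K r^n for every
      r < e^lam ([ergodic_product]).  Both come from the maximal inequality behind
      the pointwise ergodic theorem ([bounded_birkhoff_max]): if g has negative
      integral then its Birkhoff sums are almost surely bounded above.  It is
      applied to ln phi - a for a > lam and to a - ln phi for a < lam.

    - Upper bounds.  By (UE) the q^n sets of level n cover F and have diameter at
      most C P_n.  If t > s, then P_n <= K rho^n for some rho < 1 with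
      q rho^t < 1, and a set with such covers has Hausdorff, packing and upper
      box dimension at most t, by the convergence of the geometric series of
      ratio q rho^t ([hausdorff_dim_geometric_cover],
      [packing_dim_geometric_cover], [covering_number_geometric_cover]).

    - Lower bounds.  Since all words of length n have the same weight P_n, (A3)
      with exponent 1 gives a probability measure on F for which each set of level
      n has mass at most L / q^n ([A3_outer_measure]).  By (LE) a ball of radius r
      meets a bounded number of blocks of the Moran covering of scale r, and such
      a block of level n satisfies P_(n+1) <= r; with t < s and P_n >= a rho^n,
      where rho^t = 1/q, its mass is at most a constant times r^t
      ([moran_frostman]).  This Frostman condition bounds the three dimensions
      from below by the mass distribution principle
      ([frostman_hausdorff_dim], [frostman_packing_dim],
      [frostman_upper_box_dim]).

    Letting t tend to s from both sides gives [moran_dimensions], which is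
    deterministic, and the theorem follows for almost every x. *)

Set Implicit Arguments.
Unset Strict Implicit.
Unset Printing Implicit Defensive.

Local Open Scope classical_set_scope.
Local Open Scope ring_scope.

(** * An upper bound for Birkhoff sums of an ergodic system *)

Section Ergodic.
Variables (R : realType) (disp : measure_display) (M : measurableType disp).
Variables (mu : probability M R) (T : M -> M).

(** The maximum of the Birkhoff sums of lengths 1, ..., n + 1.  In this recursive
    form the increment between [birkhoff_max g n.+1 x] and
    [birkhoff_max g n (T x)] can be read off. *)
Fixpoint birkhoff_max (g : M -> R) (n : nat) (x : M) : R :=
  if n is m.+1 then g x + Num.max 0 (birkhoff_max g m (T x)) else g x.

Lemma birkhoff_max_ge (g : M -> R) n x : g x <= birkhoff_max g n x.
Proof. by case: n => [|n] //=; rewrite lerDl le_max lexx. Qed.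

Lemma birkhoff_max_le (g : M -> R) n x :
  birkhoff_max g n x <= birkhoff_max g n.+1 x.
Proof.
elim: n x => [|n IH] x /=; first by rewrite lerDl le_max lexx.
rewrite lerD2l ge_max !le_max lexx /=; apply/orP; right; exact: IH.
Qed.

Lemma birkhoff_max_mono (g : M -> R) m n x : (m <= n)%N ->
  birkhoff_max g m x <= birkhoff_max g n x.
Proof.
move=> /subnK <-; elim: (n - m)%N => // k IH.
exact: le_trans IH (birkhoff_max_le _ _ _).
Qed.

Lemma birkhoff_sum_le_max (g : M -> R) n x :
  \sum_(j < n.+1) g (iter j T x) <= birkhoff_max g n x.
Proof.
elim: n x => [|n IH] x; first by rewrite big_ord_recl big_ord0 addr0.
rewrite big_ord_recl /= lerD2l le_max; apply/orP; right.
apply: le_trans (IH (T x)); rewrite le_eqVlt; apply/orP; left; apply/eqP.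
by apply: eq_bigr => i _; rewrite -iterSr.
Qed.

Hypothesis hT : ergodic_system mu T.

(** The push-forward of mu by T is mu. *)
Lemma integral_ergodic_comp (f : M -> \bar R) :
  mu.-integrable [set: M] f -> mu.-integrable [set: M] (f \o T) /\
  (\int[mu]_x f (T x) = \int[mu]_x f x)%E.
Proof.
move=> fi; have mf := measurable_int mu fi; case: hT => mT mpT _.
have ge0T (h : M -> \bar R) : measurable_fun [set: M] h ->
    (forall x, 0 <= h x)%E -> (\int[mu]_x h (T x) = \int[mu]_x h x)%E.
  move=> mh h0.
  have := @ge0_integral_pushforward _ _ M M R T mT mu setT h measurableT mh
    (fun x _ => h0 x).
  rewrite preimage_setT => <-.
  apply: eq_measure_integral => A mA _.
  exact: (mpT A mA).
have iT : mu.-integrable [set: M] (f \o T).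
  apply/integrableP; split; first exact: measurableT_comp.
  case/integrableP : fi => _; rewrite -(ge0T (fun x => `|f x|)%E) //.
  exact: measurableT_comp.
split=> //.
have := @integral_pushforward _ _ M M R T mT mu setT f mf.
rewrite preimage_setT => /(_ iT measurableT) <-.
apply: eq_measure_integral => A mA _; exact: (mpT A mA).
Qed.

Lemma ae_ergodic_comp (P : M -> Prop) :
  {ae mu, forall x, P x} -> {ae mu, forall x, P (T x)}.
Proof.
case: hT => mT mpT _ [N [mN N0 sN]].
exists (T @^-1` N); split; last by move=> x /= Px; exact: sN.
  by rewrite -[_ @^-1` _]setTI; exact: mT.
by rewrite -N0; exact: mpT.
Qed.

Lemma ae_ergodic_iter (P : M -> Prop) :
  {ae mu, forall x, P x} -> {ae mu, forall x, forall k, P (iter k T x)}.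
Proof.
move=> hP; apply/ae_foralln => k.
elim: k => [//|k IH].
have := ae_ergodic_comp IH; apply: filterS => x.
by rewrite -iterSr.
Qed.

Section Max.
Variable g : M -> R.
Hypothesis gi : mu.-integrable [set: M] (EFin \o g).

Let mg : measurable_fun [set: M] g.
Proof. by apply/measurable_EFinP; exact: measurable_int gi. Qed.

Lemma integrable_birkhoff_max n :
  mu.-integrable [set: M] (EFin \o birkhoff_max g n).
Proof.
elim: n => [//|n IH].
have [IT _] := integral_ergodic_comp IH.
have -> : EFin \o birkhoff_max g n.+1 =
  ((EFin \o g) \+ ((EFin \o birkhoff_max g n) \o T)^\+)%E.
  apply/funext => x /=.
  by rewrite EFinD funeposE /= EFin_max maxC.
by apply: integrableD => //; exact: integrable_funepos.
Qed.

(** Let b_n be the n-th maximum and A the set where b_n is unbounded.  A is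
    invariant, hence of measure 0 or 1.  The function
    b_(n+1) - b_n o T = g + max 0 (- b_n o T) has integral at least 0, because T
    preserves mu and b_n <= b_(n+1).  On A it converges to g, and it is dominated
    by |g| + |g o T|; so if A had measure 1, the integral of g would be at least
    0. *)
Lemma bounded_birkhoff_max : (\int[mu]_x (g x)%:E < 0)%E ->
  {ae mu, forall x, exists K : nat, forall n, birkhoff_max g n x <= K%:R}.
Proof.
move=> gneg; case: (hT) => mT mpT erg.
have mb n : measurable_fun [set: M] (birkhoff_max g n).
  by apply/measurable_EFinP; exact: measurable_int (integrable_birkhoff_max n).
pose A : set M := \bigcap_(K in [set: nat]) \bigcup_(n in [set: nat])
   [set x | K%:R < birkhoff_max g n x].
have mA : measurable A.
  apply: bigcap_measurable => // K _; apply: bigcup_measurable => n _.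
  rewrite -[X in measurable X]setTI.
  have := mb n measurableT _ (measurable_itv `]K%:R, +oo[).
  by rewrite /preimage /=; under eq_set do rewrite in_itv /= andbT.
have invA : T @^-1` A = A.
  apply/seteqP; split => x /= Ax K _;
    have [/= n _ /= hn] := Ax (K + Num.Def.archi_bound `|g x|)%N I;
    have := archi_boundP (normr_ge0 (g x));
    set B := (Num.Def.archi_bound _)%:R => hB; move: hn;
    rewrite natrD -/B => hn.
  - exists n.+1 => //=; rewrite -ltrBlDl lt_max; apply/orP; right.
    apply: le_lt_trans hn; rewrite lerD2l -normrN in hB *.
    exact/ltW/(le_lt_trans (ler_norm _) hB).
  - exists n => //=; have := birkhoff_max_le g n x => /= le_b.
    have := le_lt_trans (ler_norm _) hB => gB.
    have : K%:R < Num.max 0 (birkhoff_max g n (T x)) by lra.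
    by rewrite lt_max ltNge ler0n.
have [A0|A1] := erg A mA invA.
- exists A; split=> // x /= nb; move=> K _ /=; apply: contrapT => nK.
  apply: nb; exists K => n; rewrite leNgt; apply/negP => h; apply: nK.
  by exists n.
exfalso.
pose f n x := (g x + Num.max 0 (- birkhoff_max g n (T x)))%:E.
have fE n : f n = ((EFin \o birkhoff_max g n.+1) \-
     ((EFin \o birkhoff_max g n) \o T))%E.
  apply/funext => x; rewrite /f /= -EFinB; congr (_%:E).
  set b := birkhoff_max _ _ _; rewrite -addrA; congr (_ + _).
  by rewrite !maxEle oppr_ge0; case: (ltgtP 0 b) => [?|?|<-]; lra.
have fi n : (0 <= \int[mu]_x f n x)%E.
  have [iT eT] := integral_ergodic_comp (integrable_birkhoff_max n).
  rewrite fE integralB //=; last exact: integrable_birkhoff_max n.+1.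
  rewrite [X in (_ - X)%E]eT sube_ge0.
    apply: le_integral => //; try exact: integrable_birkhoff_max.
      exact: (integrable_birkhoff_max n.+1).
    by move=> x _; rewrite lee_fin; exact: birkhoff_max_le.
  by apply/orP; left; apply: integrable_fin_num => //; exact: integrable_birkhoff_max.
have gd : mu.-integrable [set: M]
   ((abse \o (EFin \o g)) \+ (abse \o ((EFin \o g) \o T)))%E.
  have [iT _] := integral_ergodic_comp gi.
  by apply: integrableD => //; apply: integrable_abse.
have mfn n : measurable_fun [set: M] (f n).
  rewrite fE; apply: emeasurable_funB; apply/measurable_EFinP; first exact: mb.
  exact: measurableT_comp (mb n) mT.
have [||_ _] := dominated_convergence (D := setT) measurableT mfn
    (measurable_int mu gi) _ gd.
- exists (~` A); split; first exact: measurableC.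
    transitivity (1 - mu A)%E; first exact: probability_setC.
    by rewrite A1 subee.
  move=> x /= + Ax; apply => _.
  have AT : A (T x) by rewrite -[A (T x)]/((T @^-1` A) x) invA.
  have [n _ /= hn] := AT 0%N I.
  apply: cvg_near_cst; exists n => // m /= nm; rewrite /f /=.
  congr EFin; rewrite maxEle oppr_ge0 lt_geF ?addr0 //.
  exact: lt_le_trans hn (birkhoff_max_mono _ _ nm).
- apply: aeW => x n _ /=; rewrite lee_fin.
  apply: le_trans (ler_normD _ _) _; rewrite lerD2l.
  rewrite ger0_norm ?le_max ?lexx // ge_max normr_ge0 /=.
  rewrite -[X in _ <= X]normrN; apply: le_trans (ler_norm _); rewrite lerN2.
  exact: birkhoff_max_ge.
- move=> cv; move: gneg; rewrite ltNge => /negP; apply.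
  by apply: cvge_ge cv; apply: nearW.
Qed.
End Max.

(** [bounded_birkhoff_max] is applied to g - (I + 1/(k+1)), where I is the
    integral of g, for all k at once: countably many k leave a common set of full
    measure. *)
Lemma birkhoff_upper (g : M -> R) : mu.-integrable [set: M] (EFin \o g) ->
  {ae mu, forall x, forall a : R, (\int[mu]_x (g x)%:E < a%:E)%E ->
    exists K : R, forall n, \sum_(j < n) g (iter j T x) <= K + a *+ n}.
Proof.
move=> gi.
pose I : R := fine (\int[mu]_x (g x)%:E).
have IE : (\int[mu]_x (g x)%:E)%E = I%:E.
  by rewrite fineK //; exact: (integrable_fin_num measurableT gi).
have : {ae mu, forall x, forall k : nat, exists K : nat, forall n,
    birkhoff_max (fun y => g y - (I + k.+1%:R^-1)) n x <= K%:R}.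
  apply/ae_foralln => k; set b := I + _.
  have bi : mu.-integrable [set: M] (cst b%:E).
    by apply: finite_measure_integrable_cst.
  apply: bounded_birkhoff_max.
    rewrite (_ : _ \o _ = (EFin \o g) \- cst b%:E)%E //.
    exact: integrableB.
  under eq_integral do rewrite EFinB.
  rewrite (integralB measurableT gi bi) /= IE integral_cst //=.
  by rewrite probability_setT mule1 -EFinB lte_fin /b opprD addrA subrr sub0r oppr_lt0.
apply: filterS => x hx a; rewrite IE lte_fin => Ia.
pose k := Num.Def.archi_bound (a - I)^-1.
have ka : I + k.+1%:R^-1 <= a.
  have d0 : 0 < a - I by rewrite subr_gt0.
  rewrite -lerBrDl -[leRHS]invrK lef_pV2 ?posrE ?invr_gt0 //.
  have := archi_boundP (ltW (_ : 0 < (a - I)^-1)); rewrite invr_gt0 => /(_ d0).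
  by move=> /ltW /le_trans; apply; rewrite ler_nat.
have [K hK] := hx k; exists K%:R => -[|n].
  by rewrite big_ord0 mulr0n addr0.
have := le_trans (birkhoff_sum_le_max _ _ _) (hK n).
rewrite sumrB lerBlDr sumr_const card_ord => /le_trans; apply.
by rewrite lerD2l lerMn2r ka orbT.
Qed.

(** The two bounds are [birkhoff_upper] for ln phi and for - ln phi.  The starting
    point T x accounts for products that start at j = 1. *)
Lemma ergodic_product (phi : M -> R) : (forall x, 0 <= phi x) ->
  mu.-integrable [set: M] (fun x => lne (phi x)%:E) ->
  let lam := fine (\int[mu]_x lne (phi x)%:E) in
  {ae mu, forall x,
    [/\ forall k, 0 < phi (iter k T x),
        forall r, expR lam < r -> exists2 K : R, 0 < K &
          forall n, \prod_(j < n) phi (iter j.+1 T x) <= K * r ^+ n &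
        forall r, 0 < r < expR lam -> exists2 K : R, 0 < K &
          forall n, K * r ^+ n <= \prod_(j < n) phi (iter j.+1 T x)]}.
Proof.
move=> phi0 phiI lam.
(* a real-valued version of ln phi, which is -oo where phi vanishes *)
pose g x := fine (lne (phi x)%:E).
have pos : {ae mu, forall x, 0 < phi x}.
  have := integrable_ae measurableT phiI; apply: filterS => x /(_ I) /=.
  by case: ifPn => //; rewrite -ltNge.
have gE : {ae mu, forall x, [set: M] x -> lne (phi x)%:E = (g x)%:E}.
  by move: pos; apply: filterS => x px _; rewrite /g fineK // lne_EFin.
have mg : measurable_fun [set: M] g.
  exact: measurableT_comp (measurable_int mu phiI).
have gi : mu.-integrable [set: M] (EFin \o g).
  apply: le_integrable phiI => //; first exact/measurable_EFinP.
  by move=> x _; rewrite /comp /g; case: lne => [r||]; rewrite /= ?normr0 ?leey.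
have ig : (\int[mu]_x (g x)%:E = lam%:E)%E.
  rewrite /lam fineK; last exact: integrable_fin_num.
  apply: ae_eq_integral => //; first exact/measurable_EFinP.
    exact: measurable_int phiI.
  by move: gE; apply: filterS => x h t; rewrite h.
have giN : mu.-integrable [set: M] (EFin \o (fun x => - g x)).
  rewrite (_ : _ \o _ = -%E \o (EFin \o g))%E //.
  exact: integrableN.
have igN : (\int[mu]_x (- g x)%:E = (- lam)%:E)%E.
  under eq_integral do rewrite EFinN.
  rewrite integralN /= ?ig //; apply: integrable_add_def => //.
have h1 := ae_ergodic_comp (birkhoff_upper gi).
have h2 := ae_ergodic_comp (birkhoff_upper giN).
move: (ae_ergodic_iter pos) h1 h2; apply: filterS3 => x px.
rewrite ig igN => h1 h2.
have prodE n : \prod_(j < n) phi (iter j.+1 T x) =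
    expR (\sum_(j < n) g (iter j T (T x))).
  rewrite expR_sum; apply: eq_bigr => i _.
  by rewrite -iterSr /g lne_EFin // lnK // posrE; exact: (px i.+1).
split=> // r.
- move=> lr; have r0 : 0 < r by apply: lt_trans lr; exact: expR_gt0.
  have [|K hK] := h1 (ln r); first by rewrite lte_fin -ltr_expR lnK ?posrE.
  exists (expR K) => [|n]; first exact: expR_gt0.
  rewrite prodE -[r in leRHS]lnK ?posrE // -expRM_natl -expRD ler_expR mulr_natl.
  exact: hK.
- move=> /andP[r0 lr].
  have [|K hK] := h2 (- ln r); first by rewrite lte_fin ltrN2 -ltr_expR lnK ?posrE.
  exists (expR (- K)) => [|n]; first exact: expR_gt0.
  rewrite prodE -[r in leLHS]lnK ?posrE // -expRM_natl -expRD ler_expR mulr_natl.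
  by have := hK n; rewrite sumrN mulNrn; lra.
Qed.
End Ergodic.

(** * Euclidean distance, diameters and Hausdorff weights *)

Section Metric.
Variables (R : realType) (d : nat).
Implicit Types (x y z : 'rV[R]_d) (A B : set 'rV[R]_d).

Lemma eucl_distxx x : eucl_dist x x = 0.
Proof.
by rewrite /eucl_dist big1 ?sqrtr0 // => i _; rewrite subrr expr0n.
Qed.

Lemma eucl_dist_ge0 x y : 0 <= eucl_dist x y.
Proof. exact: sqrtr_ge0. Qed.

Lemma eucl_distC x y : eucl_dist x y = eucl_dist y x.
Proof.
by congr Num.sqrt; apply: eq_bigr => i _; rewrite -sqrrN opprB.
Qed.

Lemma eucl_dist_eq0 x y : eucl_dist x y <= 0 -> x = y.
Proof.
move=> h; have : eucl_dist x y == 0 by rewrite eq_le h eucl_dist_ge0.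
rewrite sqrtr_eq0 => h0.
have h1 : \sum_(i < d) (x 0 i - y 0 i) ^+ 2 == 0.
  by rewrite eq_le h0 sumr_ge0 // => i _; rewrite sqr_ge0.
apply/rowP => i; move: h1; rewrite psumr_eq0; last by move=> j _; rewrite sqr_ge0.
by move=> /allP /(_ i (mem_index_enum _)); rewrite /= sqrf_eq0 subr_eq0 => /eqP.
Qed.

(** With X = <a, b>, A = |a|^2 and B = |b|^2, the nonnegative form |t a - u b|^2
    takes the value B (A B - X^2) at t = B, u = X. *)
Lemma sum_cauchy_schwarz (a b : 'I_d -> R) :
  (\sum_i a i * b i) ^+ 2 <= (\sum_i a i ^+ 2) * (\sum_i b i ^+ 2).
Proof.
set X := \sum_i a i * b i; set A := \sum_i _; set B := \sum_i b i ^+ 2.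
have B0 : 0 <= B by apply: sumr_ge0 => i _; rewrite sqr_ge0.
have quad t u : 0 <= t ^+ 2 * A - 2 * t * u * X + u ^+ 2 * B.
  rewrite (_ : _ + _ = \sum_i (t * a i - u * b i) ^+ 2).
    by apply: sumr_ge0 => i _; rewrite sqr_ge0.
  rewrite !mulr_sumr -sumrB -big_split /=.
  by apply: eq_bigr => i _; ring.
have [B_0|Bn0] := eqVneq B 0; last first.
  have Bp : 0 < B by rewrite lt_def Bn0.
  have := quad B X.
  rewrite (_ : _ + _ = B * (A * B - X ^+ 2)); last by ring.
  by rewrite pmulr_rge0 // subr_ge0.
rewrite B_0 mulr0; have [->|Xn0] := eqVneq X 0; first by rewrite expr0n.
(* b = 0 but X != 0: this choice of u makes the form equal to - 1 *)
have := quad 1 ((A + 1) / (2 * X)); rewrite B_0.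
by rewrite (_ : _ + _ = -1) ?ler0N1 //; field.
Qed.

Lemma eucl_dist_triangle y x z : eucl_dist x z <= eucl_dist x y + eucl_dist y z.
Proof.
rewrite -[leRHS]ger0_norm ?addr_ge0 ?eucl_dist_ge0 // -sqrtr_sqr.
rewrite ler_sqrt ?sqr_ge0 // sqrrD !sqr_sqrtr; last first.
- by apply: sumr_ge0 => i _; rewrite sqr_ge0.
- by apply: sumr_ge0 => i _; rewrite sqr_ge0.
pose a i := x 0 i - y 0 i; pose b i := y 0 i - z 0 i.
have -> : \sum_(i < d) (x 0 i - z 0 i) ^+ 2 =
    \sum_i a i ^+ 2 + (\sum_i a i * b i) *+ 2 + \sum_i b i ^+ 2.
  rewrite -sumrMnl -!big_split /=; apply: eq_bigr => i _; rewrite /a /b; ring.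
rewrite lerD2r lerD2l lerMn2r /= -sqrtrM; last first.
  by apply: sumr_ge0 => i _; rewrite sqr_ge0.
apply: le_trans (ler_norm _) _; rewrite -sqrtr_sqr ler_wsqrtr //.
exact: sum_cauchy_schwarz.
Qed.

Lemma diam_ge0 A : (0 <= diam A)%E.
Proof. by rewrite le_max lexx. Qed.

Lemma eucl_dist_diam A x y : A x -> A y -> ((eucl_dist x y)%:E <= diam A)%E.
Proof.
move=> Ax Ay; rewrite le_max; apply/orP; right; apply: ereal_sup_ubound.
by exists x => //; exists y.
Qed.

Lemma diam_le A (r : R) : 0 <= r ->
  (forall x y, A x -> A y -> eucl_dist x y <= r) -> (diam A <= r%:E)%E.
Proof.
move=> r0 h; rewrite ge_max lee_fin r0 /=; apply: ge_ereal_sup.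
by move=> _ [x Ax [y Ay <-]]; rewrite lee_fin; exact: h.
Qed.

Lemma diam_set0 : diam (@set0 'rV[R]_d) = 0%E.
Proof. by apply/eqP; rewrite eq_le diam_ge0 diam_le. Qed.

Lemma hausdorff_weight_ge0 (t : R) A : (0 <= hausdorff_weight t A)%E.
Proof. by rewrite /hausdorff_weight; case: ifP => // _; exact: poweR_ge0. Qed.

Lemma hausdorff_weight_le (t r : R) A : 0 <= t -> (diam A <= r%:E)%E ->
  (hausdorff_weight t A <= (r `^ t)%:E)%E.
Proof.
move=> t0 Ar; rewrite /hausdorff_weight; case: ifP => _.
  by rewrite lee_fin powR_ge0.
rewrite -poweR_EFin gt0_ler_poweR // in_itv /= leey andbT ?diam_ge0 //.
exact: le_trans (diam_ge0 A) Ar.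
Qed.
End Metric.

Lemma geometric_small (R : realType) (a z e : R) : 0 <= z < 1 -> 0 < e ->
  exists n, a * z ^+ n <= e.
Proof.
move=> /andP[z0 z1] e0.
have : a * z ^+ n @[n --> \oo] --> a * 0.
  by apply: cvgMr; apply: cvg_expr; rewrite ger0_norm.
rewrite mulr0 => /cvgrPdist_le /(_ e e0) [n _ /(_ n (leqnn n))].
by rewrite /= sub0r normrN => h; exists n; exact: le_trans (ler_norm _) h.
Qed.

Lemma geometric_sum_le (R : realFieldType) (z : R) n : 0 <= z < 1 ->
  \sum_(i < n) z ^+ i <= (1 - z)^-1.
Proof.
move=> /andP[z0 z1]; rewrite -[leRHS]mul1r ler_pdivlMr ?subr_gt0 //.
rewrite mulrC -opprB mulNr -subrX1 opprB lerBlDr lerDl; exact: exprn_ge0.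
Qed.

Lemma powR_expr (R : realType) (x t : R) n : 0 <= x ->
  (x ^+ n) `^ t = (x `^ t) ^+ n.
Proof. by move=> x0; rewrite -!powR_mulrn ?powR_ge0 // powRAC. Qed.

(** * Upper bounds from covers of geometric size *)

Section UpperBounds.
Variables (R : realType) (d : nat).
Implicit Types (F : set 'rV[R]_d).

(** The covers that a self-similar set with q maps of ratio rho would have.  The
    shift between the exponents n + 1 and n leaves out level 0, at which the
    diameter of a Moran set need not be controlled. *)
Definition geometric_cover F (q : nat) (K rho : R) := forall n,
  exists U : 'I_(q ^ n.+1) -> set 'rV[R]_d,
    F `<=` \bigcup_i U i /\ forall i, (diam (U i) <= (K * rho ^+ n)%:E)%E.

Variables (F : set 'rV[R]_d) (q : nat) (K rho t : R).
Hypotheses (K0 : 0 < K) (rho0 : 0 < rho) (rho1 : rho < 1) (t0 : 0 <= t).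
Hypothesis subcritical : q%:R * rho `^ t < 1.
Hypothesis Fcover : geometric_cover F q K rho.

Let theta := q%:R * rho `^ t.

Let theta01 : 0 <= theta < 1.
Proof. by rewrite subcritical mulr_ge0 ?powR_ge0. Qed.

Let rho01 : 0 <= rho < 1. Proof. by rewrite ltW. Qed.

Let scale_gt0 n : 0 < K * rho ^+ n. Proof. by rewrite mulr_gt0 // exprn_gt0. Qed.

Let powR_scale n : (K * rho ^+ n) `^ t = K `^ t * (rho `^ t) ^+ n.
Proof. by rewrite powRM ?ltW ?exprn_gt0 // powR_expr // ltW. Qed.

(** The cover of index n has total weight at most q K^t theta^n. *)
Lemma hausdorff_delta_geometric_cover delta : 0 < delta ->
  (hausdorff_delta t delta F <= 0)%E.
Proof.
move=> delta0; apply/lee_addgt0Pr => e e0; rewrite add0e.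
have [n1 h1] := geometric_small K rho01 delta0.
have [n2 h2] := geometric_small (q%:R * K `^ t) theta01 e0.
pose n := maxn n1 n2; have [U [FU dU]] := Fcover n.
have mono (a z : R) i j : 0 <= a -> 0 <= z < 1 -> (i <= j)%N -> a * z ^+ j <= a * z ^+ i.
  by move=> a0 /andP[z0 z1] ij; rewrite ler_wpM2l // ler_wiXn2l // ltW.
(* the finite cover, padded with empty sets of weight 0 *)
pose V (i : nat) := oapp U set0 (insub i).
apply: ge_ereal_inf; exists (\sum_(0 <= i <oo) hausdorff_weight t (V i))%E.
  exists V => //; split.
    move=> x /FU [i _ Ux]; exists (val i) => //.
    by rewrite /V valK.
  move=> i; rewrite /V; case: insubP => [j _ _ /=|_ /=]; last first.
    by rewrite diam_set0 lee_fin ltW.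
  apply: le_trans (dU j) _; rewrite lee_fin; apply: le_trans h1.
  by apply: mono => //; [exact: ltW|exact: leq_maxl].
rewrite (nneseries_split 0 (q ^ n.+1)); last first.
  by move=> *; exact: hausdorff_weight_ge0.
rewrite add0n [X in (_ + X)%E]eseries0 ?adde0; last first.
  move=> i qi _; rewrite /V insubF ?ltnNge ?qi //=.
  by rewrite /hausdorff_weight eqxx.
rewrite big_mkord.
apply: (@le_trans _ _ (\sum_(i < q ^ n.+1) ((K * rho ^+ n) `^ t)%:E)%E).
  apply: lee_sum => i _; rewrite /V valK /=.
  exact: hausdorff_weight_le.
rewrite sumEFin lee_fin sumr_const card_ord powR_scale -mulr_natl natrX exprS.
apply: le_trans h2; apply: le_trans (mono _ _ _ _ _ theta01 (leq_maxr n1 n2)).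
  by rewrite -/n /theta exprMn le_eqVlt; apply/orP; left; apply/eqP; ring.
by rewrite mulr_ge0 // powR_ge0.
Qed.

Lemma hausdorff_measure_geometric_cover : hausdorff_measure t F = 0%E.
Proof.
apply/eqP; rewrite eq_le; apply/andP; split.
  by apply: ge_ereal_sup => _ [delta /= d0 <-]; exact: hausdorff_delta_geometric_cover.
apply: le_ereal_sup_tmp; exists (hausdorff_delta t 1 F).
  by exists 1; rewrite /= ?ltr01.
apply: le_ereal_inf_tmp => _ [V _ <-]; apply: nneseries_ge0 => i _ _.
exact: hausdorff_weight_ge0.
Qed.

Lemma hausdorff_dim_geometric_cover : (hausdorff_dim F <= t%:E)%E.
Proof.
apply: ereal_inf_lbound; exists t => //; split=> //.
exact: hausdorff_measure_geometric_cover.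
Qed.

(** Disjoint balls have centres further apart than their radii, so each set of the
    cover of index n contains at most one of the centres. *)
Lemma packing_count (D : set nat) (x : nat -> 'rV[R]_d) (r : nat -> R) n
    (s : seq nat) : uniq s ->
  (forall i, D i -> F (x i)) ->
  trivIset D (fun i => eucl_cball (x i) (r i)) ->
  (forall i, i \in s -> D i /\ K * rho ^+ n < r i) ->
  (size s <= q ^ n.+1)%N.
Proof.
move=> us Fx tD hs; have [U [FU dU]] := Fcover n.
have [->//|] := eqVneq s [::]; case: s us hs => // i0 s0; set s := i0 :: s0.
move=> us hs _.
have hU i : exists j, i \in s -> U j (x i).
  case: (boolP (i \in s)) => [si|_].
    by have [j _ Uj] := FU _ (Fx _ (hs i si).1); exists j.
  by have [j _ Uj] := FU _ (Fx _ (hs i0 (mem_head _ _)).1); exists j.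
have [h hh] := choice hU.
have inj : {in s &, injective h}.
  move=> i j si sj hij; apply: tD; [exact: (hs i si).1|exact: (hs j sj).1|].
  exists (x j); split; rewrite /eucl_cball /=; last first.
    by rewrite eucl_distxx ltW // (lt_trans _ (hs j sj).2).
  have Ui := hh i si; have Uj := hh j sj; rewrite -hij in Uj.
  have := le_trans (eucl_dist_diam Ui Uj) (dU _); rewrite lee_fin => /le_trans.
  by apply; exact: ltW (hs i si).2.
rewrite -(size_map h); have um : uniq (map h s) by rewrite map_inj_in_uniq.
by rewrite -(card_uniqP um) (leq_trans (max_card _)) // card_ord.
Qed.

Lemma geometric_level (c z y : R) : 0 < z < 1 -> 0 < c -> 0 < y <= c ->
  exists m, c * z ^+ m.+1 < y <= c * z ^+ m.
Proof.
move=> /andP[z0 z1] c0 /andP[y0 yc].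
have [m0 hm0] : exists m, c * z ^+ m < y.
  have z01 : 0 <= z < 1 by rewrite z1 ltW.
  have y2 : 0 < y / 2 by rewrite divr_gt0.
  have [m hm] := geometric_small c z01 y2.
  by exists m; apply: le_lt_trans hm _; lra.
case: (ex_minnP (ex_intro (fun m => c * z ^+ m < y) _ hm0)) => -[|m] hm min.
  by move: hm; rewrite expr0 mulr1 ltNge yc.
by exists m; rewrite hm leNgt; apply/negP => /min; rewrite ltnn.
Qed.

(* the sum over m >= n of q^(m+2) balls of weight at most (2 K rho^m)^t *)
Let packing_bound n := q%:R ^+ 2 * (2 * K) `^ t * theta ^+ n / (1 - theta).

(** The balls are grouped by level, where a radius r has level m if
    K rho^(n0+m+1) < r <= K rho^(n0+m).  There are at most q^(n0+m+2) balls of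
    level m by [packing_count], and the levels sum to a geometric series. *)
Lemma packing_sum_le n0 (D : set nat) (x : nat -> 'rV[R]_d) (r : nat -> R)
    (s : seq nat) : uniq s -> (forall i, i \in s -> D i) ->
  (forall i, D i -> F (x i) /\ 0 < r i <= K * rho ^+ n0) ->
  trivIset D (fun i => eucl_cball (x i) (r i)) ->
  \sum_(i <- s) (2 * r i) `^ t <= packing_bound n0.
Proof.
move=> us sD hD tD.
have hl i : exists m, i \in s ->
    K * rho ^+ (n0 + m).+1 < r i <= K * rho ^+ (n0 + m).
  case: (boolP (i \in s)) => [si|_]; last by exists 0%N.
  have ri := (hD i (sD i si)).2.
  have [|m] := @geometric_level (K * rho ^+ n0) rho (r i) _ (scale_gt0 n0) ri.
    by rewrite rho0.
  by move=> hm; exists m => _; rewrite -addnS !exprD !mulrA.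
have [l hl'] := choice hl.
pose M := (\max_(i <- s) l i).+1.
pose b m := (2 * (K * rho ^+ (n0 + m))) `^ t.
have lM i : i \in s -> (l i < M)%N.
  by move=> si; rewrite ltnS; exact: leq_bigmax_seq.
apply: (@le_trans _ _ (\sum_(i <- s) \sum_(m < M) (if l i == m then b m else 0))).
  rewrite big_seq [leRHS]big_seq; apply: ler_sum => i si.
  rewrite -big_mkcond (big_pred1 (Ordinal (lM i si))) => [|m].
    have /andP[_ ri] := hl' i si.
    have /andP[ri0 _] := (hD i (sD i si)).2.
    by rewrite /b ge0_ler_powR ?nnegrE ?(mulr_ge0, ler0n, exprn_ge0) ?ler_pM2l
      ?(ltW K0) ?(ltW rho0) ?(ltW ri0).
  by apply/eqP/eqP => [lim|->] //; apply: val_inj; rewrite /= lim.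
rewrite exchange_big /=.
apply: (@le_trans _ _ (\sum_(m < M) (q%:R ^+ 2 * (2 * K) `^ t * theta ^+ n0) * theta ^+ m)).
  apply: ler_sum => m _.
  rewrite -big_mkcond big_const_seq iter_addr_0 -size_filter.
  have cnt : (size [seq i <- s | l i == m] <= q ^ (n0 + m).+2)%N.
    apply: (packing_count _ (fun i Di => (hD i Di).1) tD) => [|i].
      exact: filter_uniq.
    rewrite mem_filter => /andP[/eqP <- si].
    by have /andP[? _] := hl' i si; split=> //; exact: sD.
  move: cnt; rewrite -[leLHS]mulr_natr -(ler_nat R) => cnt.
  apply: le_trans (ler_wpM2l _ cnt) _; first exact: powR_ge0.
  rewrite /b mulrA powRM ?mulr_ge0 ?exprn_ge0 ?(ltW K0) ?(ltW rho0) //.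
  rewrite powR_expr ?(ltW rho0) // natrX /theta !exprMn !exprS !exprD.
  by rewrite le_eqVlt; apply/orP; left; apply/eqP; ring.
rewrite -mulr_sumr /packing_bound ler_wpM2l ?geometric_sum_le //.
have /andP[? _] := theta01.
by rewrite !mulr_ge0 ?powR_ge0 ?exprn_ge0.
Qed.

Lemma packing_delta_ge0 (delta : R) (A : set 'rV[R]_d) :
  (0 <= packing_delta t delta A)%E.
Proof.
apply: ereal_sup_ubound; exists set0, (fun=> 0), (fun=> 0).
by split; [by []|by move=> i j []|rewrite esum_set0].
Qed.

Lemma packing_premeasure_geometric_cover : packing_premeasure t F = 0%E.
Proof.
apply/eqP; rewrite eq_le; apply/andP; split; last first.
  by apply: le_ereal_inf_tmp => _ [delta _ <-]; exact: packing_delta_ge0.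
apply/lee_addgt0Pr => e e0; rewrite add0e.
have [n0 hn0] := geometric_small (q%:R ^+ 2 * (2 * K) `^ t / (1 - theta)) theta01 e0.
apply: ge_ereal_inf; exists (packing_delta t (K * rho ^+ n0) F).
  by exists (K * rho ^+ n0) => //; exact: scale_gt0.
apply: ge_ereal_sup => _ [D [x [r [hD tD ->]]]].
apply: ge_ereal_sup => _ [X [fX XD] <-].
rewrite fsbig_finite //= sumEFin lee_fin.
apply: le_trans (le_trans _ hn0).
  apply: packing_sum_le hD tD; first exact: fset_uniq.
  by move=> i; rewrite in_fset_set // inE => /XD.
by rewrite /packing_bound le_eqVlt; apply/orP; left; apply/eqP; ring.
Qed.

(** F is decomposed as the constant sequence F, since its premeasure is already
    0. *)
Lemma packing_dim_geometric_cover : (packing_dim F <= t%:E)%E.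
Proof.
apply: ereal_inf_lbound; exists t => //; split=> //.
apply/eqP; rewrite eq_le; apply/andP; split; last first.
  apply: le_ereal_inf_tmp => _ [V _ <-]; apply: nneseries_ge0 => i _ _.
  by apply: le_ereal_inf_tmp => _ [delta _ <-]; exact: packing_delta_ge0.
apply: ge_ereal_inf; exists (\sum_(0 <= i <oo) packing_premeasure t F)%E.
  by exists (fun=> F) => // x Fx; exists 0%N.
by rewrite eseries0 // => i _ _; exact: packing_premeasure_geometric_cover.
Qed.

(** The cover of the first index m + 1 with K rho^(m+1) < r has q^(m+2) sets, and
    r^t <= K^t rho^(tm) turns their number into a power of r. *)
Lemma covering_number_geometric_cover (r : R) : 0 < r < K ->
  (covering_number F r <= (q%:R ^+ 2 * K `^ t * r `^ (- t))%:E)%E.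
Proof.
move=> /andP[r0 rK].
have rK' : 0 < r <= K by rewrite r0 ltW.
have [|m /andP[mr rm]] := @geometric_level K rho r _ K0 rK'; first by rewrite rho0.
have [U [FU dU]] := Fcover m.+1.
apply: (@le_trans _ _ (q ^ m.+2)%:R%:E).
  apply: ereal_inf_lbound; exists (q ^ m.+2)%N => //; exists U; split=> // i.
  by apply: le_trans (dU i) _; rewrite lee_fin ltW.
rewrite lee_fin powRN ler_pdivlMr ?powR_gt0 // natrX.
have rt : r `^ t <= K `^ t * (rho `^ t) ^+ m.
  by rewrite -powR_scale ge0_ler_powR // nnegrE ltW.
apply: le_trans (ler_wpM2l _ rt) _; first by rewrite exprn_ge0.
rewrite [leLHS](_ : _ = q%:R ^+ 2 * K `^ t * theta ^+ m).
  by rewrite ler_piMr ?mulr_ge0 ?powR_ge0 // exprn_ile1; case/andP: theta01 => // ? /ltW.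
by rewrite /theta exprMn !exprS; ring.
Qed.

End UpperBounds.

(** * Upper box dimension from power bounds on covering numbers *)

Section Box.
Variables (R : realType) (d : nat).
Implicit Types (F : set 'rV[R]_d).

(** Multiplicative constants disappear in the limit defining the box dimension. *)
Lemma ln_small (C e : R) : 0 < e -> exists2 eta : R, 0 < eta &
  forall r, 0 < r < eta -> ln r < 0 /\ `|ln C / - ln r| <= e.
Proof.
move=> e0; exists (expR (- ((`|ln C| + 1) / e))); first exact: expR_gt0.
move=> r /andP[r0]; rewrite -{1}(lnK r0) ltr_expR => hr.
have p : 0 < (`|ln C| + 1) / e by rewrite divr_gt0 // ltr_wpDl.
have lr : ln r < 0 by apply: lt_trans hr _; rewrite oppr_lt0.
split=> //; rewrite normrM normfV normrN (ltr0_norm lr).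
rewrite ler_pdivrMr ?oppr_gt0 // mulrC -ler_pdivrMr //.
apply: le_trans (_ : (`|ln C| + 1) / e <= _); last by rewrite lerNr ltW.
by rewrite ler_pM2r ?invr_gt0 // lerDl.
Qed.

Lemma box_ratio (C r t : R) : 0 < C -> 0 < r -> ln r < 0 ->
  (lne (C * r `^ (- t))%:E * ((- ln r)^-1)%:E = (t + ln C / - ln r)%:E)%E.
Proof.
move=> C0 r0 lr; rewrite lne_EFin ?mulr_gt0 ?powR_gt0 // -EFinM; congr EFin.
rewrite lnM ?posrE ?powR_gt0 // ln_powR; field.
by rewrite lt_eqF.
Qed.

Lemma covering_number_ge0 F r : (0 <= covering_number F r)%E.
Proof. by apply: le_ereal_inf_tmp => _ [n _ <-]; rewrite lee_fin. Qed.

Lemma upper_box_dim_le F (t C delta : R) : 0 < C -> 0 < delta ->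
  (forall r, 0 < r < delta ->
    (covering_number F r <= (C * r `^ (- t))%:E)%E) ->
  (upper_box_dim F <= t%:E)%E.
Proof.
move=> C0 delta0 hN; apply/lee_addgt0Pr => e e0.
have [eta eta0 heta] := ln_small C e0.
pose V := [set r | 0 < r < Num.min delta eta].
have hV : 0^'+ V.
  near=> r; apply/andP; split; first by [].
  by near: r; apply: nbhs_right_lt; rewrite lt_min delta0.
apply: le_trans (ereal_inf_lbound (ex_intro2 _ _ V hV erefl)) _.
apply: ge_ereal_sup => _ [r rV <-]; move: rV => /= /andP[r0].
rewrite lt_min => /andP[rd re].
have [|lr hr] := heta r; first by rewrite r0.
have i0 : 0 <= (- ln r)^-1 by rewrite invr_ge0 oppr_ge0 ltW.
have := hN r; rewrite r0 rd => /(_ isT) hNr.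
apply: (@le_trans _ _ (lne (C * r `^ (- t))%:E * ((- ln r)^-1)%:E)%E).
  rewrite lee_wpmul2r ?lee_fin // lee_lne // in_itv /= leey andbT.
    exact: covering_number_ge0.
  by rewrite lee_fin mulr_ge0 ?powR_ge0 // ltW.
rewrite box_ratio // -EFinD lee_fin lerD2l.
exact: le_trans (ler_norm _) hr.
Unshelve. all: by end_near. Qed.

Lemma upper_box_dim_ge F (t C delta : R) : 0 < C -> 0 < delta ->
  (forall r, 0 < r < delta ->
    ((C * r `^ (- t))%:E <= covering_number F r)%E) ->
  (t%:E <= upper_box_dim F)%E.
Proof.
move=> C0 delta0 hN; apply/lee_addgt0Pr => e e0.
have [eta eta0 heta] := ln_small C e0.
rewrite -leeBlDr //; apply: le_ereal_inf_tmp => _ [V hV <-].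
have : \forall r \near 0^'+, V r /\ 0 < r < Num.min delta eta.
  near=> r; split; first by near: r.
  apply/andP; split; first by [].
  by near: r; apply: nbhs_right_lt; rewrite lt_min delta0.
move=> /filter_ex [r [Vr /andP[r0]]]; rewrite lt_min => /andP[rd re].
apply: le_trans (ereal_sup_ubound (ex_intro2 _ _ r Vr erefl)).
have [|lr hr] := heta r; first by rewrite r0.
have i0 : 0 <= (- ln r)^-1 by rewrite invr_ge0 oppr_ge0 ltW.
have := hN r; rewrite r0 rd => /(_ isT) hNr.
apply: (@le_trans _ _ (lne (C * r `^ (- t))%:E * ((- ln r)^-1)%:E)%E).
  rewrite box_ratio // -EFinB lee_fin lerD2l lerNl.
  by apply: le_trans hr; rewrite -normrN ler_norm.
rewrite lee_wpmul2r ?lee_fin // lee_lne // in_itv /= leey andbT.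
  by rewrite lee_fin mulr_ge0 ?powR_ge0 // ltW.
exact: covering_number_ge0.
Unshelve. all: by end_near. Qed.
End Box.

(** * Lower bounds from a Frostman condition *)

Section LowerBounds.
Variables (R : realType) (d : nat).
Implicit Types (F U V : set 'rV[R]_d).

(** The hypothesis of the mass distribution principle.  It is stated for an outer
    measure, so that the sets F `&` U need not be measurable. *)
Definition frostman (nu : set 'rV[R]_d -> \bar R) F (t : R) :=
  exists2 K : R, 0 < K & forall y r, F y -> 0 < r ->
    (nu (F `&` eucl_ball y r) <= (K * r `^ t)%:E)%E.

Variables (F : set 'rV[R]_d) (nu : {outer_measure set 'rV[R]_d -> \bar R}).
Variable (t : R).
Hypotheses (nuF : nu F = 1%E) (t0 : 0 <= t) (frost : frostman nu F t).

Lemma outer_measure_bigcup_ord n (U : 'I_n -> set 'rV[R]_d) V :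
  V `<=` \bigcup_i U i -> (nu V <= \sum_(i < n) nu (V `&` U i))%E.
Proof.
move=> VU; pose W (i : nat) := V `&` oapp U set0 (insub i).
have -> : (\sum_(i < n) nu (V `&` U i) = \sum_(i < n) nu (W i))%E.
  by apply: eq_bigr => i _; rewrite /W valK.
apply: le_trans (outer_measure_subadditive nu W n).
apply: le_outer_measure => x Vx; have [i _ Ux] := VU x Vx.
rewrite -bigcup_mkord; exists (val i); first exact: (ltn_ord i).
by split=> //=; rewrite valK.
Qed.

(** A set U that meets F lies in a ball centred on F of any radius r > |U|.  The
    radius 2 |U| suffices if |U| > 0; if |U| = 0, letting r tend to 0 shows that
    F `&` U is null, unless t = 0, in which case every nonempty set has weight
    1. *)
Lemma frostman_weight : exists2 a : R, 0 < a & forall U,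
  (a%:E * nu (F `&` U) <= hausdorff_weight t U)%E.
Proof.
have [K K0 hK] := frost.
pose K' := K * 2 `^ t + 1.
have K2 : 0 < K * 2 `^ t by rewrite mulr_gt0 // powR_gt0.
have K'0 : 0 < K' by rewrite ltr_wpDl // ltW.
exists K'^-1; first by rewrite invr_gt0.
move=> U.
have [[y [Fy Uy]]|FU0] := pselect ((F `&` U) !=set0); last first.
  rewrite (_ : F `&` U = set0); last first.
    by apply/seteqP; split=> // z Fz; apply: FU0; exists z.
  by rewrite outer_measure0 mule0 hausdorff_weight_ge0.
rewrite lee_pdivrMl //.
have U0 : (U == set0) = false by apply/eqP => U0; move: Uy; rewrite U0.
have nu1 : (nu (F `&` U) <= 1)%E by rewrite -nuF; apply: le_outer_measure => ? [].
rewrite /hausdorff_weight U0.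
have [t_0|tn0] := eqVneq t 0.
  rewrite t_0 poweRe0 mule1; apply: le_trans nu1 _.
  by rewrite lee_fin /K' lerDr ltW.
have tp : 0 < t by rewrite lt_def tn0.
have hr (r : R) : (diam U < r%:E)%E -> (nu (F `&` U) <= (K * r `^ t)%:E)%E.
  move=> Ur; have r0 : 0 < r by rewrite -lte_fin; exact: le_lt_trans (diam_ge0 U) Ur.
  apply: le_trans (hK y r Fy r0); apply: le_outer_measure => z [Fz Uz]; split=> //.
  by rewrite /eucl_ball /= -lte_fin; exact: le_lt_trans (eucl_dist_diam Uy Uz) Ur.
case: (diam U) (diam_ge0 U) hr => [D||] //; last first.
  by move=> _ _; rewrite poweRyr // gt0_muley ?leey // lte_fin.
rewrite lee_fin le_eqVlt => /predU1P[<-|D0] hr.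
  rewrite poweR0r // mule0; apply/lee_addgt0Pr => e e0; rewrite add0e.
  have eK : 0 < e / K by rewrite divr_gt0.
  (* the radius for which K r^t = e *)
have := hr ((e / K) `^ t^-1).
  rewrite lte_fin powR_gt0 // -powRrM mulVf // powRr1 ?(ltW eK) //.
  by rewrite mulrC divfK ?gt_eqF // => /(_ isT).
have := hr (2 * D); rewrite lte_fin => /(_ _)/le_trans-> //; first by lra.
rewrite poweR_EFin -EFinM lee_fin powRM ?(ltW D0) // mulrA ler_wpM2r ?powR_ge0 //.
by rewrite /K' lerDl.
Qed.

(** The mass distribution principle: whatever set function w dominates the mass of
    F, the total w of a countable cover of F is bounded below. *)
Lemma mass_distribution (a : R) (w : set 'rV[R]_d -> \bar R) (U : (set 'rV[R]_d)^nat) :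
  0 < a -> (forall U, (a%:E * nu (F `&` U) <= w U)%E) ->
  F `<=` \bigcup_i U i -> (a%:E <= \sum_(0 <= i <oo) w (U i))%E.
Proof.
move=> a0 aw FU.
have : (nu F <= \sum_(0 <= i <oo) nu (F `&` U i))%E.
  apply: le_trans (outer_measure_sigma_subadditive nu _).
  by apply: le_outer_measure; rewrite -setI_bigcupr => x Fx; split=> //; exact: FU.
rewrite nuF -(@lee_pmul2l _ a%:E) ?lte_fin // mule1 => /le_trans; apply.
rewrite -nneseriesZl; last by move=> i _; exact: outer_measure_ge0.
apply: lee_nneseries => [i _ _|i _]; last exact: aw.
by rewrite mule_ge0 ?lee_fin ?outer_measure_ge0 // ltW.
Qed.

Lemma frostman_hausdorff_measure : hausdorff_measure t F <> 0%E.
Proof.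
have [a a0 ha] := frostman_weight.
suff : (a%:E <= hausdorff_measure t F)%E.
  by move=> + H0; rewrite H0 lee_fin leNgt a0.
apply: le_ereal_sup_tmp; exists (hausdorff_delta t 1 F).
  by exists 1; rewrite /= ?ltr01.
by apply: le_ereal_inf_tmp => _ [U [FU _] <-]; exact: mass_distribution.
Qed.

Lemma frostman_covering_number : exists2 a : R, 0 < a & forall r, 0 < r ->
  ((a * r `^ (- t))%:E <= covering_number F r)%E.
Proof.
have [a a0 ha] := frostman_weight; exists a => // r r0.
apply: le_ereal_inf_tmp => _ [n [U [FU dU]] <-].
have := outer_measure_bigcup_ord FU; rewrite nuF -(@lee_pmul2l _ a%:E) ?lte_fin // mule1.
rewrite ge0_sume_distrr; last by move=> i _; exact: outer_measure_ge0.
rewrite powRN lee_fin ler_pdivrMr ?powR_gt0 // -lee_fin => /le_trans; apply.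
apply: le_trans (_ : (\sum_(i < n) (r `^ t)%:E <= _)%E).
  apply: lee_sum => i _; apply: le_trans (ha _) _; exact: hausdorff_weight_le.
by rewrite sumEFin lee_fin sumr_const card_ord mulr_natl.
Qed.

(** n disjoint closed balls of the same radius r centred in V: it is enough to
    consider these packings for lower bounds. *)
Definition packable V (r : R) n := exists x : nat -> 'rV[R]_d,
  (forall i, (i < n)%N -> V (x i)) /\
  trivIset `I_n (fun i => eucl_cball (x i) r).

Lemma packable_delta V (r : R) n : 0 < r -> packable V r n ->
  ((n%:R * (2 * r) `^ t)%:E <= packing_delta t r V)%E.
Proof.
move=> r0 [x [Vx tx]]; apply: le_ereal_sup_tmp.
exists (\esum_(i in `I_n) ((2 * r) `^ t)%:E)%E.
  exists `I_n, x, (fun=> r); split=> // i /Vx; rewrite lexx r0.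
  by split.
rewrite esum_fset //; last by move=> i _; rewrite lee_fin powR_ge0.
rewrite -fsbig_ord sumEFin sumr_const card_ord mulr_natl //.
Qed.

(** Take a packing of F `&` V by balls of radius r with as many balls as possible.
    By maximality the balls of radius 3r with the same centres cover F `&` V, and
    (3r)^t is a constant multiple of (2r)^t, the weight of a packing ball.  If
    there are such packings with arbitrarily many balls, their weights are
    unbounded. *)
Lemma frostman_packing_delta : exists2 a : R, 0 < a & forall V r, 0 < r ->
  (a%:E * nu (F `&` V) <= packing_delta t r V)%E.
Proof.
have [K K0 hK] := frost.
pose K' := K * (3 / 2) `^ t.
have K'0 : 0 < K' by rewrite mulr_gt0 // powR_gt0.
exists K'^-1; first by rewrite invr_gt0.
move=> V r r0; set v := packing_delta t r V.
rewrite lee_pdivrMl //.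
have r2 : 0 < (2 * r) `^ t by rewrite powR_gt0 // mulr_gt0.
have pv n : packable (F `&` V) r n -> ((n%:R * (2 * r) `^ t)%:E <= v)%E.
  move=> [x [FVx tx]]; apply: packable_delta => //.
  by exists x; split=> // i /FVx [].
have [->|voo] := eqVneq v +oo%E; first by rewrite gt0_muley ?leey // lte_fin.
have p0 : packable (F `&` V) r 0 by exists (fun=> 0); split=> // i j.
have v0 : (0 <= v)%E by have := pv _ p0; rewrite mul0r.
have vE : v = (fine v)%:E by rewrite fineK // ge0_fin_numE // ltey.
pose P n := `[< packable (F `&` V) r n >].
have ubP n : P n -> (n <= Num.Def.archi_bound (fine v / (2 * r) `^ t))%N.
  move=> /asboolP /pv; rewrite vE lee_fin -ler_pdivlMr // => nv.
  rewrite -(ler_nat R); apply: le_trans nv _; apply/ltW/archi_boundP.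
  by rewrite divr_ge0 ?fine_ge0 // ltW.
case: (ex_maxnP (ex_intro P 0%N (asboolT p0)) ubP) => n /asboolP Pn maxn.
have [x [FVx tx]] := Pn.
have cov : F `&` V `<=` \bigcup_(i : 'I_n) eucl_ball (x i) (3 * r).
  move=> z FVz; apply: contrapT => nz.
  suff /maxn : P n.+1 by rewrite ltnn.
  apply/asboolP; exists (fun i => if (i < n)%N then x i else z); split.
    by move=> i _; case: ifP => // /FVx.
  have far i p : (i < n)%N -> eucl_cball (x i) r p -> eucl_cball z r p -> False.
    rewrite /eucl_cball /= => ni xp zp; apply: nz; exists (Ordinal ni) => //=.
    rewrite /eucl_ball /=; apply: le_lt_trans (eucl_dist_triangle p _ _) _.
    by rewrite (eucl_distC p); lra.
  move=> i j; rewrite /= !ltnS => ni nj [p [pi pj]].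
  move: pi pj; case: ltnP => [i_n|n_i]; case: ltnP => [j_n|n_j] // pi pj.
  - by apply: tx => //; exists p.
  - by case: (far i p).
  - by case: (far j p).
  - by apply/eqP; rewrite eqn_leq (leq_trans ni) // (leq_trans nj).
apply: le_trans (outer_measure_bigcup_ord cov) _.
apply: (@le_trans _ _ (\sum_(i < n) (K * (3 * r) `^ t)%:E)%E).
  apply: lee_sum => i _; have [Fx _] := FVx i (ltn_ord i).
  have r3 : 0 < 3 * r by rewrite mulr_gt0.
  apply: le_trans (hK _ _ Fx r3); apply: le_outer_measure => z [[Fz _] ?].
  by split.
rewrite sumEFin sumr_const card_ord.
have -> : (K * (3 * r) `^ t *+ n)%:E = (K'%:E * (n%:R * (2 * r) `^ t)%:E)%E.
  rewrite -EFinM; congr EFin; rewrite /K' -mulr_natl.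
  rewrite (_ : 3 * r = (3 / 2) * (2 * r)); last by field.
  by rewrite powRM ?divr_ge0 ?mulr_ge0 ?(ltW r0) //; ring.
by rewrite lee_pmul2l ?lte_fin //; exact: pv.
Qed.

Lemma frostman_packing_measure : packing_measure t F <> 0%E.
Proof.
have [a a0 ha] := frostman_packing_delta.
suff : (a%:E <= packing_measure t F)%E.
  by move=> + H0; rewrite H0 lee_fin leNgt a0.
apply: le_ereal_inf_tmp => _ [V FV <-]; apply: mass_distribution => // U.
by apply: le_ereal_inf_tmp => _ [r /= r0 <-]; exact: ha.
Qed.
End LowerBounds.

Section Dimensions.
Variables (R : realType) (d : nat) (F : set 'rV[R]_d).
Variable nu : {outer_measure set 'rV[R]_d -> \bar R}.
Variable s : R.
Hypothesis nuF : nu F = 1%E.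
(* t = 0 is included for the sake of s = 0, where no t satisfies 0 <= t < s *)
Hypothesis frost : forall t, 0 <= t -> t = 0 \/ t < s -> frostman nu F t.
Hypothesis s0 : 0 <= s.

Lemma frostman_hausdorff_dim : (s%:E <= hausdorff_dim F)%E.
Proof.
apply: le_ereal_inf_tmp => _ [t [t0 Ht] <-]; rewrite lee_fin leNgt.
apply/negP => ts; apply: (frostman_hausdorff_measure nuF t0 _ Ht).
by apply: frost => //; right.
Qed.

Lemma frostman_packing_dim : (s%:E <= packing_dim F)%E.
Proof.
apply: le_ereal_inf_tmp => _ [t [t0 Ht] <-]; rewrite lee_fin leNgt.
apply/negP => ts; apply: (frostman_packing_measure nuF _ Ht).
by apply: frost => //; right.
Qed.

Lemma frostman_upper_box_dim : (s%:E <= upper_box_dim F)%E.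
Proof.
have low t : 0 <= t -> t = 0 \/ t < s -> (t%:E <= upper_box_dim F)%E.
  move=> t0 ts; have [a a0 ha] := frostman_covering_number nuF t0 (frost t0 ts).
  by apply: (upper_box_dim_ge a0 (@ltr01 R)) => r /andP[r0 _]; exact: ha.
move: s0; rewrite le_eqVlt => /predU1P[<-|sp]; first by apply: low => //; left.
apply/lee_addgt0Pr => e e0; pose t := Num.max 0 (s - e).
have : (t%:E <= upper_box_dim F)%E.
  apply: low; first by rewrite le_max lexx.
  by right; rewrite gt_max sp /= gtrBl.
rewrite -(leeD2rE _ _ (_ : e%:E \is a fin_num)) //; apply: le_trans.
by rewrite -EFinD lee_fin -lerBlDr le_max lexx orbT.
Qed.
End Dimensions.

(** * Codings and measurability of generalized Moran sets *)

Section Coding.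
Variables (R : realType) (d q : nat) (S : moran_data R d q).
Hypothesis gms : is_GMS S.

Lemma diam_tri_small (e : R) : 0 < e ->
  exists k, forall w : k.-tuple 'I_q, (diam (tri S w) < e%:E)%E.
Proof.
move=> e0; have [[_ _ _ _ cv] _] := gms.
have : nbhs (0%E : \bar R) [set x | (x < e%:E)%E].
  by apply: open_nbhs_nbhs; split; [exact: open_ereal_lt_ereal|rewrite /= lte_fin].
move=> /cv [k _ /(_ k (leqnn k)) /= hk]; exists k => w.
by apply: le_lt_trans hk; apply: le_bigmax.
Qed.

Lemma GMS_eq_word k (w w' : k.-tuple 'I_q) y : moran_set S y ->
  tri S w y -> tri S w' y -> w = w'.
Proof.
move=> Fy wy w'y; apply/eqP; apply: contrapT => /negP/(gms.2 k) E.
by have : set0 y by rewrite -E.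
Qed.

(** The words w with y in tri S w are unique at each level, so they extend one
    another by nesting, and their last letters form the coding of y. *)
Lemma GMS_coding y : moran_set S y -> exists u, codes S u y.
Proof.
move=> Fy; have [[_ _ _ nest _] _] := gms.
have [W hW] : exists W : forall k, k.-tuple 'I_q, forall k, tri S (W k) y.
  have h k : {w : k.-tuple 'I_q | tri S w y}.
    by apply: cid; have [w _ wy] := Fy k I; exists w.
  by exists (fun k => sval (h k)) => k; exact: (svalP (h k)).
pose u k := tnth (W k.+1) ord_max.
have WE k : W k = prefix_word u k.
  apply: val_inj; rewrite /= -[enum _]/(enum 'I_k).
  rewrite (_ : map _ _ = mkseq u k); last first.
    by rewrite /mkseq -val_enum_ord -map_comp.
  elim: k => [|k IH]; first by rewrite tuple0.
  have sW := size_tuple (W k.+1).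
  have E : val (W k.+1) = rcons (take k (W k.+1)) (u k).
    rewrite /u (tnth_nth (u k)) -take_nth ?sW //.
    by rewrite take_oversize ?sW.
  have st : size (take k (W k.+1)) == k by rewrite size_takel // sW.
  have : Tuple st = W k.
    apply: (@GMS_eq_word _ _ _ y) => //=; apply: (nest k (Tuple st) (u k)).
    by rewrite /= -E; exact: hW.
  by move=> /(congr1 val) /= Ek; rewrite E Ek IH mkseqS.
exists u; apply/seteqP; split=> [_ -> k _|z hz]; first by rewrite -WE.
apply: eucl_dist_eq0; apply/ler_addgt0Pr => e e0; rewrite add0r.
have [k hk] := diam_tri_small e0.
have zk := hz k I; rewrite -WE in zk.
by have := le_lt_trans (eucl_dist_diam zk (hW k)) (hk _); rewrite lte_fin => /ltW.
Qed.

Lemma measurable_tri k (w : k.-tuple 'I_q) :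
  measurable (tri S w : set (borel_space R d)).
Proof.
have [[_ _ cp _ _] _] := gms.
have cl : closed (tri S w) by apply: compact_closed (cp k w); exact: norm_hausdorff.
rewrite -[X in measurable X]setCK; apply: measurableC.
by apply: sub_sigma_algebra; exact: closed_openC.
Qed.

Lemma measurable_moran_set : measurable (moran_set S : set (borel_space R d)).
Proof.
apply: bigcapT_measurable => k.
apply: fin_bigcup_measurable => [|w _]; first exact: finite_finset.
exact: measurable_tri.
Qed.
End Coding.

(** * Covers and mass of homogeneous Moran sets *)

Lemma outer_measure_big_fset (R : realType) (T : Type)
    (nu : {outer_measure set T -> \bar R}) (b : R) (N : set (set T))
    (X : set T) : finite_set N -> X `<=` \bigcup_(A in N) A ->
  (forall A, N A -> (nu A <= b%:E)%E) ->
  (nu X <= (#|` fset_set N|%:R * b)%:E)%E.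
Proof.
move=> fN XN hN; apply: (@le_trans _ _ (\sum_(A <- fset_set N) nu A)%E).
  apply: (@le_trans _ _ (nu (\big[setU/set0]_(A <- fset_set N) A))).
    by apply: le_outer_measure; rewrite -(bigcup_fset_set _ fN).
  elim/big_rec2: _ => [|A y s _ h]; first by rewrite outer_measure0.
  by apply: le_trans (outer_measureU2 nu _ _) _; exact: leeD2l.
rewrite big_seq; apply: (@le_trans _ _ (\sum_(A <- fset_set N | A \in fset_set N) b%:E)%E).
  by apply: lee_sum => A; rewrite in_fset_set // inE; exact: hN.
by rewrite -big_seq sumEFin big_const_seq count_predT iter_addr_0 mulr_natl.
Qed.

Section HomogeneousMoranSet.
Variables (R : realType) (d q : nat) (S : moran_data R d q) (p : nat -> R).
Hypothesis hq : (1 <= q)%N.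
Hypothesis gms : is_GMS S.
Let c := fun (k : nat) (_ : 'I_q) => p k.
Let P n := \prod_(j < n) p j.+1.

Lemma moran_geometric_cover (rho K : R) : 0 < K -> 0 < rho < 1 -> UE S c ->
  (forall n, P n <= K * rho ^+ n) ->
  exists2 K' : R, 0 < K' & geometric_cover (moran_set S) q K' rho.
Proof.
move=> K0 /andP[rho0 rho1] [C [C0 hC]] hP; exists (C * K); first by rewrite mulr_gt0.
move=> n.
have e : (q ^ n.+1)%N = #|{: n.+1.-tuple 'I_q}| by rewrite card_tuple card_ord.
exists (fun i => tri S (enum_val (cast_ord e i))); split.
  move=> x /(_ n.+1 I) [w _ xw]; exists (cast_ord (esym e) (enum_rank w)) => //.
  by rewrite /= cast_ordKV enum_rankK.
move=> i; apply: le_trans (hC _ _ (ltn0Sn n)) _; rewrite lee_fin -mulrA ler_pM2l //.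
apply: le_trans (hP _) _; rewrite ler_pM2l // exprS ler_piMl ?exprn_ge0 ?ltW //.
Qed.

Hypothesis Ppos : forall n, 0 < P n.

(** All words of length k have weight P k, so the powers of the weights cancel in
    (A3) and leave m (tri S w) <= L / q^k for k >= 1.  The constant L + 1 also
    covers k = 0. *)
Lemma A3_outer_measure : A3 S c ->
  exists nu : {outer_measure set 'rV[R]_d -> \bar R}, nu (moran_set S) = 1%E /\
  exists2 L : R, 0 < L & forall k (w : k.-tuple 'I_q),
     (nu (tri S w `&` moran_set S) <= (L / q%:R ^+ k)%:E)%E.
Proof.
move=> /(_ 1 ltr01) [m [L [mF L0 hm]]].
exists (mu_ext m : {outer_measure set (borel_space R d) -> \bar R}).
have nuF : mu_ext m (moran_set S) = 1%E.
  by rewrite measurable_mu_extE //; exact: measurable_moran_set.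
split=> //; exists (L + 1) => [|k w]; first by rewrite addr_gt0.
have q0 k' : 0 < q%:R ^+ k' :> R by rewrite exprn_gt0 // ltr0n.
have [k0|kp] := posnP k.
  apply: (@le_trans _ _ (mu_ext m (moran_set S))).
    by apply: le_mu_ext => ? [].
  by rewrite nuF lee_fin k0 expr0 divr1 lerDr ltW.
apply: (@le_trans _ _ (mu_ext m (tri S w))).
  by apply: le_mu_ext => ? [].
rewrite measurable_mu_extE; last exact: measurable_tri.
rewrite [leLHS](_ : _ = (fine (m (tri S w)))%:E); last first.
  rewrite fineK //; apply: fin_num_measure; exact: measurable_tri.
rewrite lee_fin.
have /andP[_] := hm k w kp.
rewrite (_ : Psi c w = P k) //.
rewrite (eq_bigr (fun=> P k)); last first.
  by move=> w' _; rewrite powRr1 //; exact: ltW (Ppos k).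
rewrite powRr1 ?(ltW (Ppos k)) // sumr_const card_tuple card_ord.
rewrite ler_pdivrMr // => /le_trans; apply.
rewrite -[P k *+ _]mulr_natl natrX invfM mulrA mulfVK ?gt_eqF //.
by rewrite ler_pM2r ?invr_gt0 // lerDl.
Qed.

(** (LE) reduces the mass of a ball of radius r to that of the blocks of the Moran
    covering of scale r.  Such a block of level n has mass at most
    L q^(-n) = L q (rho^(n+1))^t, and a rho^(n+1) <= P (n+1) <= r. *)
Lemma moran_frostman (nu : {outer_measure set 'rV[R]_d -> \bar R}) (L t rho a : R) :
  nu (moran_set S) = 1%E -> 0 < L ->
  (forall k (w : k.-tuple 'I_q),
     (nu (tri S w `&` moran_set S) <= (L / q%:R ^+ k)%:E)%E) ->
  LE S c -> 0 <= t -> 0 < rho -> rho `^ t = q%:R^-1 ->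
  0 < a -> (forall n, a * rho ^+ n <= P n) ->
  (forall r, 0 < r -> exists n, P n <= r) ->
  frostman nu (moran_set S) t.
Proof.
move=> nuF L0 hL [M0 hM] t0 rho0 rhot a0 hP P0.
have q0 k' : 0 < q%:R ^+ k' :> R by rewrite exprn_gt0 // ltr0n.
pose K := M0%:R * (L * q%:R * a^-1 `^ t).
have K0 : 0 <= K by rewrite !mulr_ge0 ?powR_ge0 // ltW.
exists (K + 1) => [|y r Fy r0]; first by rewrite ltr_wpDl.
have nu1 : (nu (moran_set S `&` eucl_ball y r) <= 1)%E.
  by rewrite -nuF; apply: le_outer_measure => ? [].
(* (LE) only concerns r < 1; for r >= 1 the total mass is the bound *)
have [r1|r1] := leP 1 r.
  apply: le_trans nu1 _; rewrite lee_fin -[leLHS]mulr1.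
  apply: ler_pM => //; first by rewrite lerDr.
  by rewrite -(powRr0 r) ler_powR.
have [|fN cN] := hM y r Fy; first by rewrite r0.
set N := [set _ | _] in fN cN.
apply: (@le_trans _ _ (#|` fset_set N|%:R * (L * q%:R * a^-1 `^ t * r `^ t))%:E).
  apply: outer_measure_big_fset => //.
    move=> z [Fz Bz]; have [u uz] := GMS_coding gms Fz.
    case: (ex_minnP (P0 r r0)) => -[|n] hn minn.
      by move: hn; rewrite /P big_ord0 leNgt r1.
    have rn : r < P n by rewrite ltNge; apply/negP => /minn; rewrite ltnn.
    exists (cylinder S (prefix_word u n)).
      split; first by exists z, u, n.
      by exists z; split=> //; split=> //; exists u.
    by split=> //; exists u.
  move=> A [[z [u [n [Fz uz rn hn ->]]]] _].
  apply: (@le_trans _ _ (nu (tri S (prefix_word u n) `&` moran_set S))).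
    apply: le_outer_measure => x [Fx [v [vx <-]]]; split=> //.
    have : [set x] x by [].
    by rewrite vx => /(_ n I).
  apply: le_trans (hL _ _) _; rewrite lee_fin -!mulrA ler_pM2l //.
  rewrite -powRM ?invr_ge0 ?(ltW a0) ?(ltW r0) //.
  have hr : rho ^+ n.+1 <= a^-1 * r.
    by rewrite mulrC ler_pdivlMr // mulrC; exact: le_trans (hP _) hn.
  apply: (@le_trans _ _ (q%:R * (rho ^+ n.+1) `^ t)).
    rewrite powR_expr ?(ltW rho0) // rhot exprS mulrA divff ?mul1r ?exprVn //.
    by rewrite gt_eqF // ltr0n.
  rewrite ler_wpM2l // ge0_ler_powR // nnegrE ?exprn_ge0 ?(ltW rho0) //.
  by rewrite mulr_ge0 ?invr_ge0 ?ltW.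
rewrite lee_fin mulrA ler_wpM2r ?powR_ge0 //.
apply: (@le_trans _ _ K); last by rewrite lerDl.
rewrite /K ler_wpM2r ?ler_nat ?(ltnW cN) //.
by rewrite !mulr_ge0 ?powR_ge0 // ltW.
Qed.
End HomogeneousMoranSet.

(** * The dimensions of a homogeneous Moran set over an ergodic system *)

Lemma ereal_dim_eq (R : realType) (D : \bar R) (s : R) :
  (s%:E <= D)%E -> (forall t, s < t -> (D <= t%:E)%E) -> D = s%:E.
Proof.
move=> h1 h2; apply/eqP; rewrite eq_le h1 andbT; apply/lee_addgt0Pr => e e0.
by rewrite -EFinD; apply: h2; rewrite ltrDl.
Qed.

Section Dim.
Variables (R : realType) (d q : nat) (S : moran_data R d q) (p : nat -> R).
Let c := fun (k : nat) (_ : 'I_q) => p k.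
Let P n := \prod_(j < n) p j.+1.

(** Only the exponential rate lam of P matters: no randomness is left. *)
Theorem moran_dimensions (lam : R) : (1 <= q)%N -> lam < 0 ->
  (forall n, 0 < P n) ->
  (forall r, expR lam < r -> exists2 K : R, 0 < K &
     forall n, P n <= K * r ^+ n) ->
  (forall r, 0 < r < expR lam -> exists2 K : R, 0 < K &
     forall n, K * r ^+ n <= P n) ->
  is_GMS S -> UE S c -> LE S c -> A3 S c ->
  let s := (- ln q%:R / lam)%:E in
  [/\ hausdorff_dim (moran_set S) = s,
      packing_dim (moran_set S) = s &
      upper_box_dim (moran_set S) = s].
Proof.
move=> hq lam0 Ppos Pup Plow gms ue le a3; set s := - ln q%:R / lam => /=.
have q0 : 0 < q%:R :> R by rewrite ltr0n.
have lq : 0 <= ln q%:R :> R by rewrite ln_ge0 // ler1n.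
have lamN : 0 < - lam by rewrite oppr_gt0.
have sE : s = ln q%:R / - lam by rewrite /s invrN mulrN mulNr.
have s0 : 0 <= s by rewrite sE divr_ge0 // ltW.
have [nu [nuF [L L0 hL]]] := A3_outer_measure hq gms Ppos a3.
have Psmall r : 0 < r -> exists n, P n <= r.
  move=> r0; have [|K K0 hK] := Pup (expR (lam / 2)).
    by rewrite ltr_expR; lra.
  have [|n hn] := @geometric_small R K (expR (lam / 2)) r _ r0.
    by rewrite expR_ge0 expR_lt1; lra.
  by exists n; exact: le_trans (hK n) hn.
have frost t : 0 <= t -> t = 0 \/ t < s -> frostman nu (moran_set S) t.
  move=> t0 t0s; have [->|tn0] := eqVneq t 0.
    exists 1 => // y r _ _; rewrite powRr0 mulr1 -nuF.
    by apply: le_outer_measure => ? [].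
  have ts : t < s by case: t0s tn0 => // ->; rewrite eqxx.
  have tp : 0 < t by rewrite lt_def tn0.
  (* chosen so that rho^t = 1/q; t < s means that rho < e^lam *)
  pose rho := expR (- (ln q%:R / t)).
  have rhot : rho `^ t = q%:R^-1.
    rewrite /rho /powR gt_eqF ?expR_gt0 // expRK mulrN mulrC divfK //.
    by rewrite expRN lnK.
  have [|a a0 ha] := Plow rho.
    rewrite expR_gt0 ltr_expR ltrNl ltr_pdivlMr //.
    by move: ts; rewrite sE ltr_pdivlMr // mulrC.
  exact: (moran_frostman hq gms nuF L0 hL le t0 (expR_gt0 _) rhot a0 ha Psmall).
have cover t : s < t -> exists K rho, [/\ 0 < K, 0 < rho, rho < 1,
    q%:R * rho `^ t < 1 & geometric_cover (moran_set S) q K rho].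
  move=> st; have tp : 0 < t by exact: le_lt_trans s0 st.
  have qt : ln q%:R / t < - lam.
    by rewrite ltr_pdivrMr //; move: st; rewrite sE ltr_pdivrMr // mulrC.
  have qt0 : 0 <= ln q%:R / t by rewrite divr_ge0 // ltW.
  (* a rate strictly between ln q / t, which makes q rho^t < 1, and - lam, which
     is the rate of decay of P *)
  pose l := (ln q%:R / t - lam) / 2.
  have l0 : 0 < l by rewrite /l; lra.
  have [|K K0 hK] := Pup (expR (- l)); first by rewrite ltr_expR /l; lra.
  have rho01 : 0 < expR (- l) < 1 by rewrite expR_gt0 expR_lt1 oppr_lt0.
  have [K' K'0 cov] := moran_geometric_cover K0 rho01 ue hK.
  exists K', (expR (- l)); case/andP: (rho01) => h0 h1; split=> //.
  rewrite /powR gt_eqF // expRK -[X in X * _]lnK ?posrE // -expRD expR_lt1.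
  rewrite mulrN subr_lt0 mulrC -ltr_pdivrMr //.
  by rewrite /l; lra.
split; apply: ereal_dim_eq.
- exact: frostman_hausdorff_dim nuF frost.
- move=> t st; have [K [rho [K0 r0 r1 sub cov]]] := cover t st.
  by apply: hausdorff_dim_geometric_cover cov => //; exact: ltW (le_lt_trans s0 st).
- exact: frostman_packing_dim nuF frost.
- move=> t st; have [K [rho [K0 r0 r1 sub cov]]] := cover t st.
  by apply: packing_dim_geometric_cover cov => //; exact: ltW (le_lt_trans s0 st).
- exact: frostman_upper_box_dim nuF frost s0.
- move=> t st; have [K [rho [K0 r0 r1 sub cov]]] := cover t st.
  have t0 := ltW (le_lt_trans s0 st).
  apply: (@upper_box_dim_le _ _ _ _ (q%:R ^+ 2 * K `^ t) K) => //.
    by rewrite mulr_gt0 ?exprn_gt0 ?powR_gt0.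
  by move=> r rK; exact: covering_number_geometric_cover cov _ rK.
Qed.
End Dim.

Theorem theorem4 (R : realType) (disp : measure_display)
  (M : measurableType disp) (mu : probability M R) (T : M -> M)
  (hT : ergodic_system mu T)
  (phi : M -> R) (hphi : forall x, 0 <= phi x < 1)
  (hphiL1 : mu.-integrable [set: M] (fun x => lne (phi x)%:E))
  (hphi_neg : (\int[mu]_x lne (phi x)%:E < 0)%E)
  (d q : nat) (hd : (1 <= d)%N) (hq : (1 <= q)%N)
  (S : M -> moran_data R d q)
  (hS : {ae mu, forall x,
     let c := fun (k : nat) (_ : 'I_q) => phi (iter k T x) in
     [/\ is_GMS (S x), basic c, homogeneous (S x) c & A3 (S x) c]}) :
  let s := (- ln q%:R / fine (\int[mu]_x lne (phi x)%:E))%:E in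
  {ae mu, forall x,
     [/\ hausdorff_dim (moran_set (S x)) = s,
         packing_dim (moran_set (S x)) = s &
         upper_box_dim (moran_set (S x)) = s]}.
Proof.
move=> s.
have phi0 x : 0 <= phi x by case/andP: (hphi x).
have lam0 : fine (\int[mu]_x lne (phi x)%:E) < 0.
  rewrite fine_lt0 // hphi_neg andbT ltNye_eq.
  by rewrite (integrable_fin_num measurableT hphiL1).
move: hS (ergodic_product hT phi0 hphiL1); apply: filterS2.
move=> x /= [gms _ [_ ue le] a3] [pos up low].
apply: (moran_dimensions (p := fun k => phi (iter k T x)) hq lam0 _ up low) => //.
by move=> n; apply: prodr_gt0.
Qed.
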